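(* If $\mathcal{I}_{Lip}^{1},\mathcal{I}_{Lip}^{2}$ are normed Lipschitz operator ideals, then $\mathcal{B}(\mathcal{I}_{Lip}^{1},\mathcal{I}_{Lip}^{2})$ is a quasi-normed two-Lipschitz operator ideal with the quasi-norm $\|\cdot\|_{\mathcal{B}(\mathcal{I}_{Lip}^{1},\mathcal{I}_{Lip}^{2})}$.
   Context: Let $\mathbb{K}$ be $\mathbb{R}$ or $\mathbb{C}$; all Banach spaces are over $\mathbb{K}$. A pointed metric space is a metric space with a distinguished base point $0$; a Banach space is a pointed metric space with base point the null vector. $Lip_0(X,Y)$ is the set of Lipschitz maps $T:X\to Y$ with $T(0)=0$ and $Lip(T)$ is the least Lipschitz constant; $X^{\#}=Lip_0(X,\mathbb{K})$. $\mathcal{L}(E,F)$ is the space of bounded linear operators and $\mathcal{B}(G_1,G_2;E)$ the space of bounded bilinear operators $G_1\times G_2\to E$ with its usual norm. A map $T:X_1\times X_2\to E$ belongs to $BLip_0(X_1,X_2;E)$ if $T(x_1,0)=T(0,x_2)=0$ for all $x_1,x_2$ and there is $C>0$ with $\|T(x_1,x_2)-T(x_1,x_2')-T(x_1',x_2)+T(x_1',x_2')\|\le C\,d(x_1,x_1')d(x_2,x_2')$ for all $x_1,x_1'\in X_1$, $x_2,x_2'\in X_2$. The least such $C$ is the norm $BLip(T)$. A Lipschitz operator ideal $\mathcal{I}_{Lip}$ is a subclass of $Lip_0$ such that for every pointed metric space $X$ and Banach space $E$ the components $\mathcal{I}_{Lip}(X,E):=Lip_0(X,E)\cap\mathcal{I}_{Lip}$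 satisfy: (i) $\mathcal{I}_{Lip}(X,E)$ is a linear subspace of $Lip_0(X,E)$; (ii) $vg:x\mapsto g(x)v$ belongs to $\mathcal{I}_{Lip}(X,E)$ for $v\in E$, $g\in X^{\#}$; (iii) if $S\in Lip_0(Y,X)$, $T\in\mathcal{I}_{Lip}(X,E)$, $w\in\mathcal{L}(E,F)$, then $wTS\in\mathcal{I}_{Lip}(Y,F)$. It is normed if there is $\|\cdot\|_{\mathcal{I}_{Lip}}:\mathcal{I}_{Lip}\to[0,\infty)$ such that each $(\mathcal{I}_{Lip}(X,E),\|\cdot\|_{\mathcal{I}_{Lip}})$ is a normed space with $Lip(T)\le\|T\|_{\mathcal{I}_{Lip}}$; $\|Id_{\mathbb{K}}\|_{\mathcal{I}_{Lip}}=1$; and $\|wTS\|_{\mathcal{I}_{Lip}}\le Lip(S)\|T\|_{\mathcal{I}_{Lip}}\|w\|$. A two-Lipschitz operator ideal $\mathcal{I}_{BLip}$ is a subclass of $BLip_0$ whose components $\mathcal{I}_{BLip}(X_1,X_2;E):=BLip_0(X_1,X_2;E)\cap\mathcal{I}_{BLip}$ satisfy: (i) each is a linear subspace of $BLip_0(X_1,X_2;E)$; (ii) each contains the maps $(x_1,x_2)\mapsto f_1(x_1)f_2(x_2)e$ for $f_j\in X_j^{\#}$, $e\in E$; (iii) if $f_1\in Lip_0(Z,X_1)$, $f_2\in Lip_0(W,X_2)$, $T\in\mathcal{I}_{BLip}(X_1,X_2;E)$, $u\in\mathcal{L}(E,F)$, then $u\circ T\circ(f_1,f_2)\in\mathcal{I}_{BLip}(Z,W;F)$.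 It is quasi-normed if there is $\|\cdot\|_{\mathcal{I}_{BLip}}:\mathcal{I}_{BLip}\to[0,\infty)$ such that (i') on each component it is a quasi-norm and $BLip(T)\le\|T\|_{\mathcal{I}_{BLip}}$; (ii') $Id_{\mathbb{K}^2}:(\alpha,\beta)\mapsto\alpha\beta$ on $\mathbb{K}\times\mathbb{K}$ has $\|Id_{\mathbb{K}^2}\|_{\mathcal{I}_{BLip}}=1$; (iii') in the situation of (iii), $\|u\circ T\circ(f_1,f_2)\|_{\mathcal{I}_{BLip}}\le\|u\|\,\|T\|_{\mathcal{I}_{BLip}}Lip(f_1)Lip(f_2)$. Strong factorization method: $T\in BLip_0(X_1,X_2;E)$ belongs to $\mathcal{B}(\mathcal{I}_{Lip}^{1},\mathcal{I}_{Lip}^{2})(X_1,X_2;E)$ iff there are Banach spaces $G_1,G_2$, $f_j\in\mathcal{I}_{Lip}^{j}(X_j,G_j)$ ($j=1,2$) and $R\in\mathcal{B}(G_1,G_2;E)$ with $T=R\circ(f_1,f_2)$; and $\|T\|_{\mathcal{B}(\mathcal{I}_{Lip}^{1},\mathcal{I}_{Lip}^{2})}=\inf\|R\|\,\|f_1\|_{\mathcal{I}_{Lip}^{1}}\|f_2\|_{\mathcal{I}_{Lip}^{2}}$, the infimum over all such factorizations. *)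

(* Defs.v *)
(* Banach spaces over K are Coquelicot's [CompleteNormedModule K], whose norm
   takes values in R; bounded linear operators are the maps satisfying
   [is_linear], which includes boundedness. *)
From Stdlib Require Import Reals.
From Coquelicot Require Import Coquelicot.

Open Scope R_scope.

(* The Banach space structure lives on the carrier of the ring itself, so that
   maps into K are maps into [scalar_banach K] by conversion. *)
Record scalar_field := ScalarField {
  scalar_ring :> AbsRing;
  scalar_class : CompleteNormedModule.class_of scalar_ring scalar_ring
}.

Definition scalar_banach (K : scalar_field) : CompleteNormedModule K :=
  CompleteNormedModule.Pack K K (scalar_class K) K.

Definition real_scalars : scalar_field :=
  ScalarField R_AbsRing
    (CompleteNormedModule.class R_AbsRing R_CompleteNormedModule).

Definition complex_scalars : scalar_field :=
  ScalarField C_AbsRing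
    (CompleteNormedModule.class C_AbsRing C_CompleteNormedModule).

Coercion Base : Metric_Space >-> Sortclass.

Record pointed_metric := PointedMetric {
  pm_space :> Metric_Space;
  pm_base : pm_space
}.

Section BanachMetric.
Context {K : AbsRing} (E : NormedModule K).

Let d (x y : E) : R := norm (minus x y).

Lemma norm_dist_pos (x y : E) : d x y >= 0.
Proof. apply Rle_ge, norm_ge_0. Qed.

Lemma norm_dist_sym (x y : E) : d x y = d y x.
Proof. unfold d; rewrite <- norm_opp, opp_minus; reflexivity. Qed.

Lemma norm_dist_refl (x y : E) : d x y = 0 <-> x = y.
Proof.
unfold d; split.
- intros H; apply norm_eq_zero in H.
  apply (plus_reg_r (opp y)).
  transitivity (zero : E); [exact H | symmetry; apply (plus_opp_r y)].
- intros ->; rewrite (minus_eq_zero y); apply norm_zero.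
Qed.

Lemma norm_dist_tri (x y z : E) : d x y <= d x z + d z y.
Proof. unfold d; rewrite (minus_trans z x y); apply norm_triangle. Qed.

Definition norm_metric : Metric_Space :=
  Build_Metric_Space E d norm_dist_pos norm_dist_sym norm_dist_refl
    norm_dist_tri.
End BanachMetric.

Definition banach_pm {K : AbsRing} (E : CompleteNormedModule K)
  : pointed_metric := PointedMetric (norm_metric E) (zero : E).

Definition scalar_pm (K : scalar_field) : pointed_metric :=
  banach_pm (scalar_banach K).

Definition lip_bound (X Y : pointed_metric) (T : X -> Y) (C : R) : Prop :=
  0 <= C /\ forall x x' : X, dist Y (T x) (T x') <= C * dist X x x'.

Definition Lip0 (X Y : pointed_metric) (T : X -> Y) : Prop :=
  T (pm_base X) = pm_base Y /\ exists C, lip_bound X Y T C.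

Definition Lip (X Y : pointed_metric) (T : X -> Y) : R :=
  real (Glb_Rbar (lip_bound X Y T)).

Definition op_norm {K : AbsRing} {E F : NormedModule K} (w : E -> F) : R :=
  real (Lub_Rbar (fun r => exists x : E, norm x <= 1 /\ r = norm (w x))).

Definition is_bilinear {K : AbsRing} {G1 G2 E : NormedModule K}
    (B : G1 * G2 -> E) : Prop :=
  (forall y : G2, is_linear (fun x : G1 => B (x, y))) /\
  (forall x : G1, is_linear (fun y : G2 => B (x, y))) /\
  exists M, forall (x : G1) (y : G2), norm (B (x, y)) <= M * norm x * norm y.

Definition bilinear_norm {K : AbsRing} {G1 G2 E : NormedModule K}
    (B : G1 * G2 -> E) : R :=
  real (Lub_Rbar (fun r => exists (x : G1) (y : G2),
    norm x <= 1 /\ norm y <= 1 /\ r = norm (B (x, y)))).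

Definition blip_bound {K : AbsRing} {X1 X2 : pointed_metric}
    {E : CompleteNormedModule K} (T : X1 * X2 -> E) (C : R) : Prop :=
  0 <= C /\
  forall (x1 x1' : X1) (x2 x2' : X2),
    norm (plus (minus (minus (T (x1, x2)) (T (x1, x2'))) (T (x1', x2)))
               (T (x1', x2')))
    <= C * dist X1 x1 x1' * dist X2 x2 x2'.

Definition BLip0 {K : AbsRing} {X1 X2 : pointed_metric}
    {E : CompleteNormedModule K} (T : X1 * X2 -> E) : Prop :=
  (forall x1 : X1, T (x1, pm_base X2) = zero) /\
  (forall x2 : X2, T (pm_base X1, x2) = zero) /\
  exists C, blip_bound T C.

Definition BLip {K : AbsRing} {X1 X2 : pointed_metric}
    {E : CompleteNormedModule K} (T : X1 * X2 -> E) : R :=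
  real (Glb_Rbar (blip_bound T)).

Definition linear_subspace {K : AbsRing} {A : Type} {E : ModuleSpace K}
    (P : (A -> E) -> Prop) : Prop :=
  P (fun _ => zero) /\
  (forall u v, P u -> P v -> P (fun a => plus (u a) (v a))) /\
  (forall (c : K) u, P u -> P (fun a => scal c (u a))).

Definition quasi_norm_with {K : AbsRing} {A : Type} {E : ModuleSpace K}
    (kappa : R) (P : (A -> E) -> Prop) (N : (A -> E) -> R) : Prop :=
  (forall u, P u -> 0 <= N u) /\
  (forall u, P u -> N u = 0 -> forall a, u a = zero) /\
  (forall (c : K) u, P u -> N (fun a => scal c (u a)) = abs c * N u) /\
  (forall u v, P u -> P v ->
    N (fun a => plus (u a) (v a)) <= kappa * (N u + N v)).

Definition is_norm_on {K : AbsRing} {A : Type} {E : ModuleSpace K}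
    (P : (A -> E) -> Prop) (N : (A -> E) -> R) : Prop :=
  quasi_norm_with 1 P N.

Definition is_quasi_norm_on {K : AbsRing} {A : Type} {E : ModuleSpace K}
    (P : (A -> E) -> Prop) (N : (A -> E) -> R) : Prop :=
  exists kappa, 1 <= kappa /\ quasi_norm_with kappa P N.

Definition lip_class (K : AbsRing) : Type :=
  forall (X : pointed_metric) (E : CompleteNormedModule K), (X -> E) -> Prop.

(* Norms on classes are total functions; only their values on members of the
   class are ever constrained or used. *)
Definition lip_norm (K : AbsRing) : Type :=
  forall (X : pointed_metric) (E : CompleteNormedModule K), (X -> E) -> R.

Definition blip_class (K : AbsRing) : Type :=
  forall (X1 X2 : pointed_metric) (E : CompleteNormedModule K),
    (X1 * X2 -> E) -> Prop.

Definition blip_norm (K : AbsRing) : Type :=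
  forall (X1 X2 : pointed_metric) (E : CompleteNormedModule K),
    (X1 * X2 -> E) -> R.

Record lip_operator_ideal (K : scalar_field) (I : lip_class K) : Prop := {
  loi_Lip0 : forall (X : pointed_metric) (E : CompleteNormedModule K)
      (T : X -> E), I X E T -> Lip0 X (banach_pm E) T;
  loi_subspace : forall (X : pointed_metric) (E : CompleteNormedModule K),
    linear_subspace (I X E);
  loi_rank_one : forall (X : pointed_metric) (E : CompleteNormedModule K)
      (v : E) (g : X -> K),
    Lip0 X (scalar_pm K) g -> I X E (fun x => scal (g x) v);
  loi_comp : forall (X Y : pointed_metric) (E F : CompleteNormedModule K)
      (S : Y -> X) (T : X -> E) (w : E -> F),
    Lip0 Y X S -> I X E T -> is_linear w -> I Y F (fun y => w (T (S y)))
}.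

Record normed_lip_operator_ideal (K : scalar_field)
    (I : lip_class K) (N : lip_norm K) : Prop := {
  nloi_ideal : lip_operator_ideal K I;
  nloi_norm : forall (X : pointed_metric) (E : CompleteNormedModule K),
    is_norm_on (I X E) (N X E);
  nloi_Lip : forall (X : pointed_metric) (E : CompleteNormedModule K)
      (T : X -> E),
    I X E T -> Lip X (banach_pm E) T <= N X E T;
  nloi_id : N (scalar_pm K) (scalar_banach K) (fun x : K => x) = 1;
  nloi_comp : forall (X Y : pointed_metric) (E F : CompleteNormedModule K)
      (S : Y -> X) (T : X -> E) (w : E -> F),
    Lip0 Y X S -> I X E T -> is_linear w ->
    N Y F (fun y => w (T (S y))) <= Lip Y X S * N X E T * op_norm w
}.

Record two_lip_operator_ideal (K : scalar_field) (I : blip_class K)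
    : Prop := {
  tloi_BLip0 : forall (X1 X2 : pointed_metric) (E : CompleteNormedModule K)
      (T : X1 * X2 -> E), I X1 X2 E T -> BLip0 T;
  tloi_subspace : forall (X1 X2 : pointed_metric) (E : CompleteNormedModule K),
    linear_subspace (I X1 X2 E);
  tloi_rank_one : forall (X1 X2 : pointed_metric) (E : CompleteNormedModule K)
      (f1 : X1 -> K) (f2 : X2 -> K) (e : E),
    Lip0 X1 (scalar_pm K) f1 -> Lip0 X2 (scalar_pm K) f2 ->
    I X1 X2 E (fun x => scal (mult (f1 (fst x)) (f2 (snd x))) e);
  tloi_comp : forall (X1 X2 Z W : pointed_metric)
      (E F : CompleteNormedModule K) (f1 : Z -> X1) (f2 : W -> X2)
      (T : X1 * X2 -> E) (u : E -> F),
    Lip0 Z X1 f1 -> Lip0 W X2 f2 -> I X1 X2 E T -> is_linear u ->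
    I Z W F (fun x => u (T (f1 (fst x), f2 (snd x))))
}.

Record quasi_normed_two_lip_operator_ideal (K : scalar_field)
    (I : blip_class K) (N : blip_norm K) : Prop := {
  qtloi_ideal : two_lip_operator_ideal K I;
  qtloi_quasi_norm : forall (X1 X2 : pointed_metric)
      (E : CompleteNormedModule K),
    is_quasi_norm_on (I X1 X2 E) (N X1 X2 E);
  qtloi_BLip : forall (X1 X2 : pointed_metric) (E : CompleteNormedModule K)
      (T : X1 * X2 -> E),
    I X1 X2 E T -> BLip T <= N X1 X2 E T;
  qtloi_id : N (scalar_pm K) (scalar_pm K) (scalar_banach K)
    (fun x : K * K => mult (fst x) (snd x)) = 1;
  qtloi_comp : forall (X1 X2 Z W : pointed_metric)
      (E F : CompleteNormedModule K) (f1 : Z -> X1) (f2 : W -> X2)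
      (T : X1 * X2 -> E) (u : E -> F),
    Lip0 Z X1 f1 -> Lip0 W X2 f2 -> I X1 X2 E T -> is_linear u ->
    N Z W F (fun x => u (T (f1 (fst x), f2 (snd x))))
    <= op_norm u * N X1 X2 E T * Lip Z X1 f1 * Lip W X2 f2
}.

Definition strong_factorization {K : AbsRing} (I1 I2 : lip_class K)
    {X1 X2 : pointed_metric} {E : CompleteNormedModule K} (T : X1 * X2 -> E)
    (G1 G2 : CompleteNormedModule K) (f1 : X1 -> G1) (f2 : X2 -> G2)
    (B : G1 * G2 -> E) : Prop :=
  I1 X1 G1 f1 /\ I2 X2 G2 f2 /\ is_bilinear B /\
  forall x1 x2, T (x1, x2) = B (f1 x1, f2 x2).

Definition strong_ideal {K : AbsRing} (I1 I2 : lip_class K) : blip_class K :=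
  fun X1 X2 E T =>
    BLip0 T /\
    exists (G1 G2 : CompleteNormedModule K) (f1 : X1 -> G1) (f2 : X2 -> G2)
      (B : G1 * G2 -> E),
      strong_factorization I1 I2 T G1 G2 f1 f2 B.

Definition strong_ideal_norm {K : AbsRing} (I1 I2 : lip_class K)
    (N1 N2 : lip_norm K) : blip_norm K :=
  fun X1 X2 E T =>
    real (Glb_Rbar (fun r =>
      exists (G1 G2 : CompleteNormedModule K) (f1 : X1 -> G1) (f2 : X2 -> G2)
        (B : G1 * G2 -> E),
        strong_factorization I1 I2 T G1 G2 f1 f2 B /\
        r = bilinear_norm B * N1 X1 G1 f1 * N2 X2 G2 f2)).

(* Main.v *)
Require Import Defs.
From Stdlib Require Import Reals Lra Classical FunctionalExtensionality.
From Coquelicot Require Import Coquelicot.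

(** Everything rests on transporting factorizations T = B(f1, f2).

    Composing T with Lipschitz maps on the right and a bounded linear map u on
    the left composes f1, f2 on the right and B on the left; the norms multiply,
    and taking infima gives the ideal inequality ([strong_ideal_comp]).  In the same
    way, multiplying B by a scalar c gives |cT| <= |c| |T| for the factorization
    norm, and applying this to the inverse of c gives equality.

    A factorization bounds the mixed second difference of T: by bilinearity it
    is B evaluated at the increments of f1 and f2, which are controlled by the
    ideal norms because these dominate Lip ([factorization_blip_bound]).  Hence
    T is two-Lipschitz and BLip(T) is at most the factorization norm; in
    particular a map of norm 0 vanishes.

    For sums, S = B(f1, f2) and T = D(g1, g2) combine into
    S + T = (B + D)((f1, g1), (f2, g2)), through the Hilbertian direct sums of
    the intermediate spaces.  By the Cauchy-Schwarz inequality the norm of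
    B + D is at most the larger of the norms of B and D, whereas the norm of
    (f_j, g_j) is only bounded by the sum of those of f_j and g_j.  So the
    factorizations are balanced first ([normalized_factorization]): if the norm
    of S is less than s, scaling achieves |B| <= 1 and |f1|, |f2| <= sqrt s, and
    likewise for T and t.  The sum then has norm at most
    (sqrt s + sqrt t)^2 <= 2 (s + t), so the quasi-norm constant 2 works.

    Finally the product of scalars factors through the two identity maps and
    itself, which gives norm at most 1, and its BLip constant is at least 1. *)

(** * Infima and suprema of sets of reals *)

(** A nonempty set with a real lower bound has a real infimum, so the projection
    from the extended reals, which sends the infinities to 0, loses nothing. *)
Lemma Glb_Rbar_finite (S : R -> Prop) (m : R) :
  (exists x, S x) -> (forall y, S y -> m <= y) ->
  is_glb_Rbar S (real (Glb_Rbar S)).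
Proof.
intros [x Hx] Hm.
destruct (Glb_Rbar_correct S) as [Hlb Hglb].
assert (H1 := Hlb x Hx).
assert (H2 : Rbar_le m (Glb_Rbar S)) by (apply Hglb; intros y Hy; exact (Hm y Hy)).
destruct (Glb_Rbar S); simpl in *; easy.
Qed.

Lemma Glb_Rbar_le (S : R -> Prop) (m x : R) :
  (forall y, S y -> m <= y) -> S x -> real (Glb_Rbar S) <= x.
Proof.
intros Hm Hx.
exact (proj1 (Glb_Rbar_finite S m (ex_intro _ x Hx) Hm) x Hx).
Qed.

Lemma le_Glb_Rbar (S : R -> Prop) (m : R) :
  (exists x, S x) -> (forall y, S y -> m <= y) -> m <= real (Glb_Rbar S).
Proof.
intros He Hm.
exact (proj2 (Glb_Rbar_finite S m He Hm) (Finite m) (fun y Hy => Hm y Hy)).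
Qed.

Lemma Glb_Rbar_approx (S : R -> Prop) (r : R) :
  (exists x, S x) -> real (Glb_Rbar S) < r -> exists x, S x /\ x < r.
Proof.
intros He Hr; apply NNPP; intros Hn.
assert (H : r <= real (Glb_Rbar S)); [| lra].
apply le_Glb_Rbar; [exact He |].
intros y Hy; destruct (Rle_or_lt r y) as [H | H]; [exact H |].
exfalso; apply Hn; exists y; split; assumption.
Qed.

Lemma Lub_Rbar_finite (S : R -> Prop) (M : R) :
  (exists x, S x) -> (forall y, S y -> y <= M) ->
  is_lub_Rbar S (real (Lub_Rbar S)).
Proof.
intros [x Hx] HM.
destruct (Lub_Rbar_correct S) as [Hub Hlub].
assert (H1 := Hub x Hx).
assert (H2 : Rbar_le (Lub_Rbar S) M) by (apply Hlub; intros y Hy; exact (HM y Hy)).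
destruct (Lub_Rbar S); simpl in *; easy.
Qed.

Lemma le_Lub_Rbar (S : R -> Prop) (M x : R) :
  (forall y, S y -> y <= M) -> S x -> x <= real (Lub_Rbar S).
Proof.
intros HM Hx.
exact (proj1 (Lub_Rbar_finite S M (ex_intro _ x Hx) HM) x Hx).
Qed.

Lemma Lub_Rbar_le (S : R -> Prop) (M : R) :
  (exists x, S x) -> (forall y, S y -> y <= M) -> real (Lub_Rbar S) <= M.
Proof.
intros He HM.
exact (proj2 (Lub_Rbar_finite S M He HM) (Finite M) (fun y Hy => HM y Hy)).
Qed.

(** * Lipschitz constants *)

Lemma dist_ge_0 (X : pointed_metric) (x x' : X) : 0 <= dist X x x'.
Proof. apply Rge_le, dist_pos. Qed.

Lemma Lip_ge_0 (X Y : pointed_metric) (f : X -> Y) : Lip0 X Y f -> 0 <= Lip X Y f.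
Proof. intros [_ He]; apply le_Glb_Rbar; [exact He | intros y Hy; apply Hy]. Qed.

Lemma Lip_le (X Y : pointed_metric) (f : X -> Y) (C : R) :
  lip_bound X Y f C -> Lip X Y f <= C.
Proof. apply Glb_Rbar_le with 0; intros y Hy; apply Hy. Qed.

(** The infimum defining Lip is attained: dividing by a positive distance turns
    the inequality into a lower bound of the set of Lipschitz constants, and at
    distance 0 any one Lipschitz constant suffices. *)
Lemma dist_le_Lip (X Y : pointed_metric) (f : X -> Y) (x x' : X) :
  Lip0 X Y f -> dist Y (f x) (f x') <= Lip X Y f * dist X x x'.
Proof.
intros [_ He].
destruct (dist_ge_0 X x x') as [Hd | Hd].
- apply Rmult_le_reg_r with (/ dist X x x'); [apply Rinv_0_lt_compat, Hd |].
  rewrite Rmult_assoc, Rinv_r, Rmult_1_r by lra.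
  apply le_Glb_Rbar; [exact He |].
  intros C [_ HC].
  apply Rmult_le_reg_r with (dist X x x'); [exact Hd |].
  rewrite Rmult_assoc, Rinv_l, Rmult_1_r by lra; apply HC.
- destruct He as [C [_ HC]].
  generalize (HC x x'); rewrite <- Hd, !Rmult_0_r; intros H; exact H.
Qed.

Lemma Lip0_id (X : pointed_metric) : Lip0 X X (fun x => x).
Proof. split; [reflexivity | exists 1; split; intros; lra]. Qed.

Lemma Lip_id_le (X : pointed_metric) : Lip X X (fun x => x) <= 1.
Proof. apply Lip_le; split; intros; lra. Qed.

(** * Scalars *)

Lemma scalar_mult_comm (K : scalar_field)
    (HK : K = real_scalars \/ K = complex_scalars) (a b : K) :
  mult a b = mult b a.
Proof. destruct HK as [-> | ->]; [apply Rmult_comm | apply Cmult_comm]. Qed.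

Lemma scalar_inv (K : scalar_field)
    (HK : K = real_scalars \/ K = complex_scalars) (c : K) :
  c = zero \/ exists c' : K, mult c' c = one /\ abs c' * abs c = 1.
Proof.
destruct HK as [-> | ->].
- destruct (Req_dec (c : R) 0) as [-> | Hc]; [left; reflexivity | right].
  exists (/ c)%R; split.
  + exact (Rinv_l c Hc).
  + change (Rabs (/ c) * Rabs c = 1).
    rewrite <- Rabs_mult, (Rinv_l c Hc); apply Rabs_R1.
- destruct (classic ((c : C) = RtoC 0)) as [-> | Hc]; [left; reflexivity | right].
  exists (Cinv c); split.
  + exact (Cinv_l c Hc).
  + change (Cmod (Cinv c) * Cmod c = 1).
    rewrite <- Cmod_mult, (Cinv_l c Hc); apply Cmod_1.
Qed.

Lemma scalar_of_abs (K : scalar_field)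
    (HK : K = real_scalars \/ K = complex_scalars) (r : R) :
  0 < r -> exists c : K, abs c = r.
Proof.
intros Hr; destruct HK as [-> | ->].
- exists (r : R); exact (Rabs_pos_eq r (Rlt_le _ _ Hr)).
- exists (RtoC r).
  change (Cmod (RtoC r) = r); rewrite Cmod_R; apply Rabs_pos_eq; lra.
Qed.

(** This makes it possible to rescale vectors by any prescribed positive factor,
    which over a general ring with an absolute value need not be possible. *)
Lemma scalar_of_abs_inv (K : scalar_field)
    (HK : K = real_scalars \/ K = complex_scalars) (r : R) :
  0 < r -> exists c c' : K, mult c' c = one /\ abs c = r /\ abs c' = / r.
Proof.
intros Hr; destruct (scalar_of_abs K HK r Hr) as [c Hc].
destruct (scalar_inv K HK c) as [-> | (c' & H1 & H2)].
- rewrite abs_zero in Hc; lra.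
- exists c, c'; repeat split; try assumption.
  rewrite Hc in H2; field_simplify_eq; lra.
Qed.

(** * Bounded linear and bilinear maps *)

Lemma scal_scal_inv {K : AbsRing} {E : ModuleSpace K} (c c' : K) (x : E) :
  mult c' c = one -> scal c' (scal c x) = x.
Proof. intros H; rewrite scal_assoc, H; exact (scal_one x). Qed.

Lemma op_norm_le {K : AbsRing} {E F : NormedModule K} (w : E -> F) (M : R) :
  (forall x, norm x <= 1 -> norm (w x) <= M) -> op_norm w <= M.
Proof.
intros HM; apply Lub_Rbar_le.
- exists (norm (w zero)), zero; split; [rewrite norm_zero; lra | reflexivity].
- intros y (x & Hx & ->); exact (HM x Hx).
Qed.

Lemma le_op_norm {K : AbsRing} {E F : NormedModule K} (w : E -> F) (x : E) :
  is_linear w -> norm x <= 1 -> norm (w x) <= op_norm w.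
Proof.
intros Hw Hx; destruct (linear_norm w Hw) as (M & HM & H).
apply le_Lub_Rbar with M; [| exists x; split; [exact Hx | reflexivity]].
intros y (z & Hz & ->); generalize (H z); nra.
Qed.

Lemma op_norm_ge_0 {K : AbsRing} {E F : NormedModule K} (w : E -> F) :
  is_linear w -> 0 <= op_norm w.
Proof.
intros Hw; apply Rle_trans with (norm (w zero)); [apply norm_ge_0 |].
apply le_op_norm; [exact Hw | rewrite norm_zero; lra].
Qed.

(** The norm axiom for scalar multiplication is only an inequality, so rescaling
    is expressed through a pair of mutually inverse scalars with known absolute
    values rather than through the norm of the rescaled vector. *)
Lemma unit_rescaling (K : scalar_field)
    (HK : K = real_scalars \/ K = complex_scalars) (E : NormedModule K) (x : E) :
  x = zero \/
  exists c c' : K, mult c' c = one /\ norm (scal c x) <= 1 /\ abs c' = norm x.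
Proof.
destruct (norm_ge_0 x) as [Hx | Hx].
- right; destruct (scalar_of_abs_inv K HK (/ norm x)) as (c & c' & H1 & H2 & H3).
  + apply Rinv_0_lt_compat, Hx.
  + exists c, c'; repeat split; [exact H1 | | rewrite H3; apply Rinv_inv].
    apply Rle_trans with (1 := norm_scal c x).
    rewrite H2, Rinv_l; lra.
- left; apply norm_eq_zero; symmetry; exact Hx.
Qed.

Lemma norm_le_op_norm (K : scalar_field)
    (HK : K = real_scalars \/ K = complex_scalars) (E F : NormedModule K)
    (w : E -> F) (x : E) :
  is_linear w -> norm (w x) <= op_norm w * norm x.
Proof.
intros Hw; destruct (unit_rescaling K HK E x) as [-> | (c & c' & H1 & H2 & H3)].
- rewrite linear_zero, !norm_zero by exact Hw; lra.
- rewrite <- (scal_scal_inv c c' (w x) H1), <- (linear_scal w Hw).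
  apply Rle_trans with (1 := norm_scal c' _).
  rewrite H3, Rmult_comm; apply Rmult_le_compat_r; [apply norm_ge_0 |].
  apply le_op_norm; assumption.
Qed.

Lemma bilinear_norm_le {K : AbsRing} {G1 G2 E : NormedModule K}
    (B : G1 * G2 -> E) (M : R) :
  (forall x y, norm x <= 1 -> norm y <= 1 -> norm (B (x, y)) <= M) ->
  bilinear_norm B <= M.
Proof.
intros HM; apply Lub_Rbar_le.
- exists (norm (B (zero, zero))), zero, zero.
  rewrite !norm_zero; repeat split; lra.
- intros r (x & y & Hx & Hy & ->); exact (HM x y Hx Hy).
Qed.

Lemma le_bilinear_norm {K : AbsRing} {G1 G2 E : NormedModule K}
    (B : G1 * G2 -> E) (x : G1) (y : G2) :
  is_bilinear B -> norm x <= 1 -> norm y <= 1 -> norm (B (x, y)) <= bilinear_norm B.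
Proof.
intros (_ & _ & M & HM) Hx Hy.
apply le_Lub_Rbar with (Rabs M).
- intros r (z & t & Hz & Ht & ->).
  apply Rle_trans with (1 := HM z t).
  assert (H1 := Rle_abs M); assert (H2 := Rabs_pos M).
  assert (H3 := norm_ge_0 z); assert (H4 := norm_ge_0 t).
  assert (H5 : 0 <= norm z * norm t <= 1) by (split; nra).
  rewrite Rmult_assoc; nra.
- exists x, y; repeat split; assumption.
Qed.

Lemma bilinear_norm_ge_0 {K : AbsRing} {G1 G2 E : NormedModule K}
    (B : G1 * G2 -> E) : is_bilinear B -> 0 <= bilinear_norm B.
Proof.
intros HB; apply Rle_trans with (norm (B (zero, zero))); [apply norm_ge_0 |].
apply le_bilinear_norm; [exact HB | rewrite norm_zero; lra..].
Qed.

Lemma norm_le_bilinear_norm (K : scalar_field)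
    (HK : K = real_scalars \/ K = complex_scalars) (G1 G2 E : NormedModule K)
    (B : G1 * G2 -> E) (x : G1) (y : G2) :
  is_bilinear B -> norm (B (x, y)) <= bilinear_norm B * norm x * norm y.
Proof.
intros HB; pose proof HB as (HB1 & HB2 & _).
destruct (unit_rescaling K HK G1 x) as [-> | (c & c' & H1 & H2 & H3)].
{ rewrite (linear_zero _ (HB1 y)), !norm_zero; lra. }
destruct (unit_rescaling K HK G2 y) as [-> | (d & d' & D1 & D2 & D3)].
{ rewrite (linear_zero _ (HB2 x)), !norm_zero; lra. }
assert (HBc : B (x, y) = scal c' (scal d' (B (scal c x, scal d y)))).
{ transitivity (scal c' (B (scal c x, y))).
  - rewrite (linear_scal _ (HB1 y) c x : B (scal c x, y) = scal c (B (x, y))).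
    symmetry; apply scal_scal_inv, H1.
  - f_equal.
    rewrite (linear_scal _ (HB2 (scal c x)) d y
      : B (scal c x, scal d y) = scal d (B (scal c x, y))).
    symmetry; apply scal_scal_inv, D1. }
rewrite HBc.
apply Rle_trans with (1 := norm_scal c' _).
assert (H4 := norm_scal d' (B (scal c x, scal d y))).
assert (H5 := le_bilinear_norm B (scal c x) (scal d y) HB H2 D2).
rewrite H3; rewrite D3 in H4.
assert (H6 := norm_ge_0 x); assert (H7 := norm_ge_0 y).
apply Rle_trans with (norm x * (norm y * bilinear_norm B)); [| lra].
apply Rmult_le_compat_l; [exact H6 |].
apply Rle_trans with (1 := H4); apply Rmult_le_compat_l; assumption.
Qed.

Lemma bilinear_postcomp (K : scalar_field)
    (HK : K = real_scalars \/ K = complex_scalars) (G1 G2 E F : NormedModule K)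
    (B : G1 * G2 -> E) (u : E -> F) :
  is_bilinear B -> is_linear u ->
  is_bilinear (fun p => u (B p)) /\
  bilinear_norm (fun p => u (B p)) <= op_norm u * bilinear_norm B.
Proof.
intros HB Hu; pose proof HB as (HB1 & HB2 & _).
assert (H0 := op_norm_ge_0 u Hu).
split; [split; [| split] |].
- intros y; exact (is_linear_comp _ u (HB1 y) Hu).
- intros x; exact (is_linear_comp _ u (HB2 x) Hu).
- exists (op_norm u * bilinear_norm B); intros x y.
  apply Rle_trans with (1 := norm_le_op_norm K HK _ _ u (B (x, y)) Hu).
  rewrite !Rmult_assoc; apply Rmult_le_compat_l; [exact H0 |].
  rewrite <- Rmult_assoc; apply norm_le_bilinear_norm; assumption.
- apply bilinear_norm_le; intros x y Hx Hy.
  apply Rle_trans with (1 := norm_le_op_norm K HK _ _ u (B (x, y)) Hu).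
  apply Rmult_le_compat_l; [exact H0 |].
  apply le_bilinear_norm; assumption.
Qed.

Lemma scal_linear (K : scalar_field)
    (HK : K = real_scalars \/ K = complex_scalars) (E : NormedModule K) (c : K) :
  is_linear (fun x : E => scal c x) /\ op_norm (fun x : E => scal c x) <= abs c.
Proof.
split.
- apply is_linear_scal_r; intros a b; apply scalar_mult_comm, HK.
- apply op_norm_le; intros x Hx.
  apply Rle_trans with (1 := norm_scal c x).
  assert (H := abs_ge_0 c); nra.
Qed.

Lemma op_norm_id_le {K : AbsRing} (E : NormedModule K) :
  op_norm (fun x : E => x) <= 1.
Proof. apply op_norm_le; intros x Hx; exact Hx. Qed.

Lemma bilinear_zero {K : AbsRing} (G1 G2 E : NormedModule K) :
  is_bilinear (fun _ : G1 * G2 => zero : E).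
Proof.
split; [| split].
- intros y; apply is_linear_zero.
- intros x; apply is_linear_zero.
- exists 0; intros x y; rewrite norm_zero; lra.
Qed.

(** The Banach space on the carrier of K is an abstract component of K: its norm,
    addition and scalar multiplication agree with those of the ring K only
    because K is one of the two concrete fields. *)
Lemma scalar_banach_norm (K : scalar_field)
    (HK : K = real_scalars \/ K = complex_scalars) (x : scalar_banach K) :
  norm x = abs (x : K).
Proof. destruct HK as [-> | ->]; reflexivity. Qed.

Lemma scalar_banach_plus (K : scalar_field)
    (HK : K = real_scalars \/ K = complex_scalars) (x y : scalar_banach K) :
  plus x y = plus (x : K) (y : K).
Proof. destruct HK as [-> | ->]; reflexivity. Qed.

Lemma scalar_banach_scal (K : scalar_field)
    (HK : K = real_scalars \/ K = complex_scalars) (k : K) (x : scalar_banach K) :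
  scal k x = mult k (x : K).
Proof. destruct HK as [-> | ->]; reflexivity. Qed.

Lemma scalar_scal_linear (K : scalar_field)
    (HK : K = real_scalars \/ K = complex_scalars) (E : NormedModule K) (e : E) :
  is_linear (fun k : scalar_banach K => scal (k : K) e).
Proof.
split.
- intros x y; transitivity (scal (plus (x : K) (y : K)) e).
  + exact (f_equal (fun k : K => scal k e) (scalar_banach_plus K HK x y)).
  + exact (scal_distr_r (x : K) (y : K) e).
- intros k x; transitivity (scal (mult k (x : K)) e).
  + exact (f_equal (fun k : K => scal k e) (scalar_banach_scal K HK k x)).
  + symmetry; exact (scal_assoc k (x : K) e).
- exists (norm e + 1); split; [assert (H := norm_ge_0 e); lra |].
  intros x; rewrite scalar_banach_norm by exact HK.
  apply Rle_trans with (1 := norm_scal (x : K) e).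
  assert (H := abs_ge_0 (x : K)); lra.
Qed.

Definition scalar_mult (K : scalar_field)
    (p : scalar_banach K * scalar_banach K) : scalar_banach K :=
  mult (fst p : K) (snd p : K).

Lemma scalar_mult_bilinear (K : scalar_field)
    (HK : K = real_scalars \/ K = complex_scalars) :
  is_bilinear (scalar_mult K) /\ bilinear_norm (scalar_mult K) <= 1.
Proof.
assert (Hn : forall x y, norm (scalar_mult K (x, y)) <= 1 * norm x * norm y).
{ intros x y; rewrite !scalar_banach_norm, Rmult_1_l by exact HK.
  apply abs_mult. }
split; [split; [| split] |].
- intros y; apply is_linear_ext with (fun x : scalar_banach K =>
    scal (x : K) (y : scalar_banach K)).
  + intros x; apply scalar_banach_scal, HK.
  + apply scalar_scal_linear, HK.
- intros x; apply is_linear_ext with (fun y : scalar_banach K => scal (x : K) y).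
  + intros y; apply scalar_banach_scal, HK.
  + apply scal_linear, HK.
- exists 1; exact Hn.
- apply bilinear_norm_le; intros x y Hx Hy.
  apply Rle_trans with (1 := Hn x y).
  assert (H1 := norm_ge_0 x); assert (H2 := norm_ge_0 y); nra.
Qed.

(** * Direct sums of Banach spaces *)

Lemma prod_complete_cauchy {U V : CompleteSpace} (F : (U * V -> Prop) -> Prop) :
  ProperFilter F -> cauchy F ->
  forall eps : posreal,
    F (ball ((lim (filtermap fst F), lim (filtermap snd F)) : U * V) eps).
Proof.
intros HF HC eps.
assert (H1 : filtermap fst F (ball (lim (filtermap fst F)) eps)).
{ apply complete_cauchy; [apply filtermap_proper_filter, HF |].
  intros e; destruct (HC e) as [[x y] Hxy]; exists x.
  apply filter_imp with (2 := Hxy); intros z Hz; apply Hz. }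
assert (H2 : filtermap snd F (ball (lim (filtermap snd F)) eps)).
{ apply complete_cauchy; [apply filtermap_proper_filter, HF |].
  intros e; destruct (HC e) as [[x y] Hxy]; exists y.
  apply filter_imp with (2 := Hxy); intros z Hz; apply Hz. }
unfold filtermap in H1, H2; exact (filter_and (F := F) _ _ H1 H2).
Qed.

Lemma prod_close_lim {U V : CompleteSpace} (F1 F2 : (U * V -> Prop) -> Prop) :
  filter_le F1 F2 -> filter_le F2 F1 ->
  close ((lim (filtermap fst F1), lim (filtermap snd F1)) : U * V)
    (lim (filtermap fst F2), lim (filtermap snd F2)).
Proof.
intros H12 H21 eps; split.
- exact (close_lim (filtermap fst F1) (filtermap fst F2)
    (fun P => H12 _) (fun P => H21 _) eps).
- exact (close_lim (filtermap snd F1) (filtermap snd F2)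
    (fun P => H12 _) (fun P => H21 _) eps).
Qed.

(** The Hilbertian direct sum: the norm is sqrt (|x|^2 + |y|^2), which makes the
    Cauchy-Schwarz inequality available for sums of bilinear maps. *)
Definition prod_banach {K : AbsRing} (U V : CompleteNormedModule K) :
    CompleteNormedModule K :=
  CompleteNormedModule.Pack K (U * V)
    (CompleteNormedModule.Class K (U * V)
       (NormedModule.class K (prod_NormedModule K U V))
       (CompleteSpace.Mixin (prod_UniformSpace U V)
          (fun F => (lim (filtermap fst F), lim (filtermap snd F)))
          prod_complete_cauchy prod_close_lim))
    (U * V).

Lemma norm_prod_sqr {K : AbsRing} (U V : CompleteNormedModule K)
    (p : prod_banach U V) : norm p ^ 2 = norm (fst p) ^ 2 + norm (snd p) ^ 2.
Proof.
change (prod_norm p ^ 2 = norm (fst p) ^ 2 + norm (snd p) ^ 2).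
unfold prod_norm; apply pow2_sqrt; nra.
Qed.

Lemma norm_inl {K : AbsRing} (U V : CompleteNormedModule K) (x : U) :
  norm ((x, zero) : prod_banach U V) = norm x.
Proof.
apply Rsqr_inj; [apply norm_ge_0.. |].
rewrite !Rsqr_pow2, norm_prod_sqr; simpl fst; simpl snd.
rewrite (norm_zero : norm (zero : V) = 0); ring.
Qed.

Lemma norm_inr {K : AbsRing} (U V : CompleteNormedModule K) (y : V) :
  norm ((zero, y) : prod_banach U V) = norm y.
Proof.
apply Rsqr_inj; [apply norm_ge_0.. |].
rewrite !Rsqr_pow2, norm_prod_sqr; simpl fst; simpl snd.
rewrite (norm_zero : norm (zero : U) = 0); ring.
Qed.

Lemma inl_linear {K : AbsRing} (U V : CompleteNormedModule K) :
  is_linear (fun x : U => (x, zero) : prod_banach U V) /\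
  op_norm (fun x : U => (x, zero) : prod_banach U V) <= 1.
Proof.
split.
- exact (is_linear_prod (fun x : U => x) (fun _ => zero : V)
    is_linear_id is_linear_zero).
- apply op_norm_le; intros x Hx; rewrite norm_inl; exact Hx.
Qed.

Lemma inr_linear {K : AbsRing} (U V : CompleteNormedModule K) :
  is_linear (fun y : V => (zero, y) : prod_banach U V) /\
  op_norm (fun y : V => (zero, y) : prod_banach U V) <= 1.
Proof.
split.
- exact (is_linear_prod (fun _ => zero : U) (fun y : V => y)
    is_linear_zero is_linear_id).
- apply op_norm_le; intros x Hx; rewrite norm_inr; exact Hx.
Qed.

Lemma is_linear_add {K : AbsRing} (U V : NormedModule K) (l m : U -> V) :
  is_linear l -> is_linear m -> is_linear (fun x => plus (l x) (m x)).
Proof.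
intros Hl Hm.
exact (is_linear_comp _ _ (is_linear_prod l m Hl Hm) is_linear_plus).
Qed.

Definition bilinear_sum {K : AbsRing} {G1 G2 H1 H2 E : CompleteNormedModule K}
    (B : G1 * G2 -> E) (D : H1 * H2 -> E)
    (p : prod_banach G1 H1 * prod_banach G2 H2) : E :=
  plus (B (fst (fst p), fst (snd p))) (D (snd (fst p), snd (snd p))).

Lemma Cauchy_Schwarz_2 (a b c d p q : R) :
  0 <= p -> 0 <= q -> p ^ 2 = a ^ 2 + b ^ 2 -> q ^ 2 = c ^ 2 + d ^ 2 ->
  a * c + b * d <= p * q.
Proof.
intros Hp Hq H1 H2.
apply Rsqr_incr_0_var; [| apply Rmult_le_pos; assumption].
rewrite Rsqr_mult, !Rsqr_pow2, H1, H2.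
assert (H := pow2_ge_0 (a * d - b * c)); lra.
Qed.

(** The direct sum of two bilinear maps is no larger than the larger of the two:
    |x1||y1| + |x2||y2| <= |(x1, x2)||(y1, y2)| by Cauchy-Schwarz. *)
Lemma bilinear_sum_bounded (K : scalar_field)
    (HK : K = real_scalars \/ K = complex_scalars)
    (G1 G2 H1 H2 E : CompleteNormedModule K)
    (B : G1 * G2 -> E) (D : H1 * H2 -> E) (M : R) :
  is_bilinear B -> is_bilinear D -> bilinear_norm B <= M -> bilinear_norm D <= M ->
  is_bilinear (bilinear_sum B D) /\ bilinear_norm (bilinear_sum B D) <= M.
Proof.
intros HB HD HBM HDM.
assert (HM : 0 <= M) by (apply Rle_trans with (2 := HBM), bilinear_norm_ge_0, HB).
assert (Hn : forall x y,
  norm (bilinear_sum B D (x, y)) <= M * norm x * norm y).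
{ intros [x1 x2] [y1 y2]; unfold bilinear_sum; simpl fst; simpl snd.
  apply Rle_trans with (1 := norm_triangle (B (x1, y1)) (D (x2, y2))).
  assert (HB' := norm_le_bilinear_norm K HK _ _ _ B x1 y1 HB).
  assert (HD' := norm_le_bilinear_norm K HK _ _ _ D x2 y2 HD).
  assert (Hc := Cauchy_Schwarz_2 _ _ _ _ _ _
    (norm_ge_0 _) (norm_ge_0 _)
    (norm_prod_sqr _ _ ((x1, x2) : prod_banach G1 H1))
    (norm_prod_sqr _ _ ((y1, y2) : prod_banach G2 H2))).
  simpl fst in Hc; simpl snd in Hc.
  assert (P1 := Rmult_le_pos _ _ (norm_ge_0 x1) (norm_ge_0 y1)).
  assert (P2 := Rmult_le_pos _ _ (norm_ge_0 x2) (norm_ge_0 y2)).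
  assert (Q1 := Rmult_le_compat_r _ _ _ P1 HBM).
  assert (Q2 := Rmult_le_compat_r _ _ _ P2 HDM).
  assert (Q3 := Rmult_le_compat_l _ _ _ HM Hc).
  apply Rle_trans with (1 := Rplus_le_compat _ _ _ _ HB' HD').
  rewrite (Rmult_assoc M); apply Rle_trans with (2 := Q3).
  rewrite Rmult_plus_distr_l, !(Rmult_assoc (bilinear_norm _)).
  exact (Rplus_le_compat _ _ _ _ Q1 Q2). }
split; [split; [| split] |].
- intros [y1 y2]; exact (is_linear_add (prod_banach G1 H1) E
    (fun x => B (fst x, y1)) (fun x => D (snd x, y2))
    (is_linear_comp _ _ is_linear_fst (proj1 HB y1))
    (is_linear_comp _ _ is_linear_snd (proj1 HD y2))).
- intros [x1 x2]; exact (is_linear_add (prod_banach G2 H2) E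
    (fun y => B (x1, fst y)) (fun y => D (x2, snd y))
    (is_linear_comp _ _ is_linear_fst (proj1 (proj2 HB) x1))
    (is_linear_comp _ _ is_linear_snd (proj1 (proj2 HD) x2))).
- exists M; exact Hn.
- apply bilinear_norm_le; intros x y Hx Hy.
  apply Rle_trans with (1 := Hn x y).
  assert (P1 := norm_ge_0 x); assert (P2 := norm_ge_0 y).
  rewrite Rmult_assoc; assert (norm x * norm y <= 1) by nra; nra.
Qed.

(** * Normed Lipschitz operator ideals *)

Lemma lip_ideal_norm_ge_0 (K : scalar_field) (I : lip_class K) (N : lip_norm K)
    (X : pointed_metric) (E : CompleteNormedModule K) (f : X -> E) :
  normed_lip_operator_ideal K I N -> I X E f -> 0 <= N X E f.
Proof. intros H; apply (nloi_norm _ _ _ H X E). Qed.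

Lemma lip_ideal_comp (K : scalar_field) (I : lip_class K) (N : lip_norm K)
    (X Y : pointed_metric) (E : CompleteNormedModule K) (h : Y -> X) (f : X -> E) :
  normed_lip_operator_ideal K I N -> Lip0 Y X h -> I X E f ->
  I Y E (fun y => f (h y)) /\ N Y E (fun y => f (h y)) <= Lip Y X h * N X E f.
Proof.
intros H Hh Hf; split.
- exact (loi_comp _ _ (nloi_ideal _ _ _ H) X Y E E h f (fun x => x)
    Hh Hf is_linear_id).
- apply Rle_trans with (1 := nloi_comp _ _ _ H X Y E E h f (fun x => x)
    Hh Hf is_linear_id).
  rewrite <- (Rmult_1_r (Lip Y X h * N X E f)) at 2.
  apply Rmult_le_compat_l; [| apply op_norm_id_le].
  apply Rmult_le_pos; [apply Lip_ge_0, Hh | apply (lip_ideal_norm_ge_0 K I N); assumption].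
Qed.

Lemma lip_ideal_postcomp (K : scalar_field) (I : lip_class K) (N : lip_norm K)
    (X : pointed_metric) (E F : CompleteNormedModule K) (f : X -> E) (w : E -> F) :
  normed_lip_operator_ideal K I N -> I X E f -> is_linear w ->
  I X F (fun x => w (f x)) /\ N X F (fun x => w (f x)) <= op_norm w * N X E f.
Proof.
intros H Hf Hw; split.
- exact (loi_comp _ _ (nloi_ideal _ _ _ H) X X E F (fun x => x) f w
    (Lip0_id X) Hf Hw).
- apply Rle_trans with (1 := nloi_comp _ _ _ H X X E F (fun x => x) f w
    (Lip0_id X) Hf Hw).
  rewrite (Rmult_comm (op_norm w)); apply Rmult_le_compat_r.
  + apply op_norm_ge_0, Hw.
  + assert (H0 := lip_ideal_norm_ge_0 K I N X E f H Hf).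
    assert (H1 := Lip_id_le X); nra.
Qed.

(** The pair (f, g) is the sum of f and g composed with the two isometric
    injections into the direct sum. *)
Lemma lip_ideal_pair (K : scalar_field) (I : lip_class K) (N : lip_norm K)
    (X : pointed_metric) (U V : CompleteNormedModule K) (f : X -> U) (g : X -> V) :
  normed_lip_operator_ideal K I N -> I X U f -> I X V g ->
  I X (prod_banach U V) (fun x => (f x, g x)) /\
  N X (prod_banach U V) (fun x => (f x, g x)) <= N X U f + N X V g.
Proof.
intros H Hf Hg.
destruct (inl_linear U V) as [Hl Hl1]; destruct (inr_linear U V) as [Hr Hr1].
destruct (lip_ideal_postcomp K I N X _ _ f _ H Hf Hl) as [Jf Nf].
destruct (lip_ideal_postcomp K I N X _ _ g _ H Hg Hr) as [Jg Ng].
replace (fun x => (f x, g x) : prod_banach U V) with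
  (fun x => plus ((f x, zero) : prod_banach U V) ((zero, g x) : prod_banach U V)).
2: { apply functional_extensionality; intros x.
     exact (f_equal2 pair (plus_zero_r (f x)) (plus_zero_l (g x))). }
split.
- apply (loi_subspace _ _ (nloi_ideal _ _ _ H) X (prod_banach U V)); assumption.
- assert (Ht := proj2 (proj2 (proj2 (nloi_norm _ _ _ H X (prod_banach U V))))
    _ _ Jf Jg).
  assert (H1 := lip_ideal_norm_ge_0 K I N X U f H Hf).
  assert (H2 := lip_ideal_norm_ge_0 K I N X V g H Hg).
  apply Rle_trans with (1 := Ht); rewrite Rmult_1_l.
  apply Rplus_le_compat.
  + apply Rle_trans with (1 := Nf); rewrite <- (Rmult_1_l (N X U f)) at 2.
    apply Rmult_le_compat_r; assumption.
  + apply Rle_trans with (1 := Ng); rewrite <- (Rmult_1_l (N X V g)) at 2.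
    apply Rmult_le_compat_r; assumption.
Qed.

Lemma lip_ideal_scal (K : scalar_field) (I : lip_class K) (N : lip_norm K)
    (X : pointed_metric) (E : CompleteNormedModule K) (c : K) (f : X -> E) :
  normed_lip_operator_ideal K I N -> I X E f ->
  I X E (fun x => scal c (f x)) /\ N X E (fun x => scal c (f x)) = abs c * N X E f.
Proof.
intros H Hf; split.
- apply (loi_subspace _ _ (nloi_ideal _ _ _ H) X E), Hf.
- apply (nloi_norm _ _ _ H X E), Hf.
Qed.

Lemma lip_ideal_dist (K : scalar_field) (I : lip_class K) (N : lip_norm K)
    (X : pointed_metric) (E : CompleteNormedModule K) (f : X -> E) (x x' : X) :
  normed_lip_operator_ideal K I N -> I X E f ->
  norm (minus (f x) (f x')) <= N X E f * dist X x x'.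
Proof.
intros H Hf.
apply Rle_trans with (1 := dist_le_Lip X (banach_pm E) f x x'
  (loi_Lip0 _ _ (nloi_ideal _ _ _ H) X E f Hf)).
apply Rmult_le_compat_r; [apply dist_ge_0 | apply (nloi_Lip _ _ _ H), Hf].
Qed.

(** A K-valued map g is the rank-one map x |-> g(x) 1. *)
Lemma lip_ideal_scalar (K : scalar_field)
    (HK : K = real_scalars \/ K = complex_scalars) (I : lip_class K)
    (X : pointed_metric) (g : X -> K) :
  lip_operator_ideal K I -> Lip0 X (scalar_pm K) g -> I X (scalar_banach K) g.
Proof.
intros H Hg.
assert (Hr := loi_rank_one _ _ H X (scalar_banach K) (one : K) g Hg).
replace g with (fun x => scal (g x) ((one : K) : scalar_banach K)); [exact Hr |].
apply functional_extensionality; intros x.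
transitivity (mult (g x) (one : K)); [apply scalar_banach_scal, HK | apply mult_one_r].
Qed.

(** * The class of strongly factorable maps *)

Lemma minus_minus {G : AbelianGroup} (x y z : G) :
  plus (minus x y) z = minus x (minus y z).
Proof.
change (plus (plus x (opp y)) z = plus x (opp (minus y z))).
rewrite opp_minus, <- plus_assoc; f_equal; apply plus_comm.
Qed.

Lemma bilinear_second_difference {K : AbsRing} (G1 G2 E : NormedModule K)
    (B : G1 * G2 -> E) (a a' : G1) (b b' : G2) :
  is_bilinear B ->
  plus (minus (minus (B (a, b)) (B (a, b'))) (B (a', b))) (B (a', b')) =
  B (minus a a', minus b b').
Proof.
intros (HB1 & HB2 & _).
rewrite (linear_minus _ a a' (HB1 (minus b b'))
  : B (minus a a', minus b b') = minus (B (a, minus b b')) (B (a', minus b b'))).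
rewrite (linear_minus _ b b' (HB2 a)
  : B (a, minus b b') = minus (B (a, b)) (B (a, b'))).
rewrite (linear_minus _ b b' (HB2 a')
  : B (a', minus b b') = minus (B (a', b)) (B (a', b'))).
exact (minus_minus _ _ _).
Qed.

Lemma factorization_blip_bound (K : scalar_field)
    (HK : K = real_scalars \/ K = complex_scalars)
    (I1 I2 : lip_class K) (N1 N2 : lip_norm K)
    (X1 X2 : pointed_metric) (E : CompleteNormedModule K) (T : X1 * X2 -> E)
    (G1 G2 : CompleteNormedModule K) (f1 : X1 -> G1) (f2 : X2 -> G2)
    (B : G1 * G2 -> E) :
  normed_lip_operator_ideal K I1 N1 -> normed_lip_operator_ideal K I2 N2 ->
  strong_factorization I1 I2 T G1 G2 f1 f2 B ->
  blip_bound T (bilinear_norm B * N1 X1 G1 f1 * N2 X2 G2 f2).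
Proof.
intros HI1 HI2 (Hf1 & Hf2 & HB & HT).
assert (P0 := bilinear_norm_ge_0 B HB).
assert (P1 := lip_ideal_norm_ge_0 _ _ _ _ _ _ HI1 Hf1).
assert (P2 := lip_ideal_norm_ge_0 _ _ _ _ _ _ HI2 Hf2).
split; [repeat apply Rmult_le_pos; assumption |].
intros x1 x1' x2 x2'; rewrite !HT.
apply Rle_trans with (1 := Req_le _ _ (f_equal norm
  (bilinear_second_difference _ _ _ B (f1 x1) (f1 x1') (f2 x2) (f2 x2') HB))).
apply Rle_trans with (1 := norm_le_bilinear_norm K HK _ _ _ B _ _ HB).
assert (D1 := lip_ideal_dist _ _ _ _ _ _ x1 x1' HI1 Hf1).
assert (D2 := lip_ideal_dist _ _ _ _ _ _ x2 x2' HI2 Hf2).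
apply Rle_trans with (bilinear_norm B *
  ((N1 X1 G1 f1 * dist X1 x1 x1') * (N2 X2 G2 f2 * dist X2 x2 x2'))); [| lra].
rewrite Rmult_assoc; apply Rmult_le_compat_l; [exact P0 |].
apply Rmult_le_compat; [apply norm_ge_0.. | exact D1 | exact D2].
Qed.

Lemma strong_ideal_intro (K : scalar_field)
    (HK : K = real_scalars \/ K = complex_scalars)
    (I1 I2 : lip_class K) (N1 N2 : lip_norm K)
    (X1 X2 : pointed_metric) (E : CompleteNormedModule K) (T : X1 * X2 -> E)
    (G1 G2 : CompleteNormedModule K) (f1 : X1 -> G1) (f2 : X2 -> G2)
    (B : G1 * G2 -> E) :
  normed_lip_operator_ideal K I1 N1 -> normed_lip_operator_ideal K I2 N2 ->
  strong_factorization I1 I2 T G1 G2 f1 f2 B -> strong_ideal I1 I2 X1 X2 E T.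
Proof.
intros HI1 HI2 HF; pose proof HF as (Hf1 & Hf2 & (HB1 & HB2 & _) & HT).
split; [split; [| split] |].
- intros x1; rewrite HT.
  rewrite (proj1 (loi_Lip0 _ _ (nloi_ideal _ _ _ HI2) _ _ _ Hf2)).
  exact (linear_zero _ (HB2 (f1 x1))).
- intros x2; rewrite HT.
  rewrite (proj1 (loi_Lip0 _ _ (nloi_ideal _ _ _ HI1) _ _ _ Hf1)).
  exact (linear_zero _ (HB1 (f2 x2))).
- eexists; exact (factorization_blip_bound K HK _ _ _ _ _ _ _ _ _ _ _ _ _ HI1 HI2 HF).
- exists G1, G2, f1, f2, B; exact HF.
Qed.

Lemma strong_norm_le (K : scalar_field)
    (I1 I2 : lip_class K) (N1 N2 : lip_norm K)
    (X1 X2 : pointed_metric) (E : CompleteNormedModule K) (T : X1 * X2 -> E)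
    (G1 G2 : CompleteNormedModule K) (f1 : X1 -> G1) (f2 : X2 -> G2)
    (B : G1 * G2 -> E) :
  normed_lip_operator_ideal K I1 N1 -> normed_lip_operator_ideal K I2 N2 ->
  strong_factorization I1 I2 T G1 G2 f1 f2 B ->
  strong_ideal_norm I1 I2 N1 N2 X1 X2 E T <=
  bilinear_norm B * N1 X1 G1 f1 * N2 X2 G2 f2.
Proof.
intros HI1 HI2 HF; apply Glb_Rbar_le with 0.
- intros r (L1 & L2 & g1 & g2 & D & (Hg1 & Hg2 & HD & _) & ->).
  repeat apply Rmult_le_pos; [apply bilinear_norm_ge_0, HD | |].
  + apply (lip_ideal_norm_ge_0 _ _ _ _ _ _ HI1 Hg1).
  + apply (lip_ideal_norm_ge_0 _ _ _ _ _ _ HI2 Hg2).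
- exists G1, G2, f1, f2, B; split; [exact HF | reflexivity].
Qed.

Lemma le_strong_norm (K : scalar_field)
    (I1 I2 : lip_class K) (N1 N2 : lip_norm K)
    (X1 X2 : pointed_metric) (E : CompleteNormedModule K) (T : X1 * X2 -> E) (m : R) :
  strong_ideal I1 I2 X1 X2 E T ->
  (forall G1 G2 f1 f2 B, strong_factorization I1 I2 T G1 G2 f1 f2 B ->
     m <= bilinear_norm B * N1 X1 G1 f1 * N2 X2 G2 f2) ->
  m <= strong_ideal_norm I1 I2 N1 N2 X1 X2 E T.
Proof.
intros (_ & G1 & G2 & f1 & f2 & B & HF) Hm; apply le_Glb_Rbar.
- eexists; exists G1, G2, f1, f2, B; split; [exact HF | reflexivity].
- intros r (L1 & L2 & g1 & g2 & D & HD & ->); apply Hm, HD.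
Qed.

(** Multiplication by k commutes with the infimum over all factorizations; for
    k = 0 this needs the existence of a factorization. *)
Lemma le_mult_strong_norm (K : scalar_field)
    (I1 I2 : lip_class K) (N1 N2 : lip_norm K)
    (X1 X2 : pointed_metric) (E : CompleteNormedModule K) (T : X1 * X2 -> E)
    (k m : R) :
  0 <= k -> strong_ideal I1 I2 X1 X2 E T ->
  (forall G1 G2 f1 f2 B, strong_factorization I1 I2 T G1 G2 f1 f2 B ->
     m <= k * (bilinear_norm B * N1 X1 G1 f1 * N2 X2 G2 f2)) ->
  m <= k * strong_ideal_norm I1 I2 N1 N2 X1 X2 E T.
Proof.
intros [Hk | <-] HT Hm.
- apply Rmult_le_reg_l with (/ k); [apply Rinv_0_lt_compat, Hk |].
  rewrite <- Rmult_assoc, Rinv_l, Rmult_1_l by lra.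
  apply le_strong_norm; [exact HT |].
  intros G1 G2 f1 f2 B HF.
  apply Rmult_le_reg_l with k; [exact Hk |].
  rewrite <- Rmult_assoc, Rinv_r, Rmult_1_l by lra; apply Hm, HF.
- destruct HT as (_ & G1 & G2 & f1 & f2 & B & HF).
  generalize (Hm _ _ _ _ _ HF); lra.
Qed.

Lemma strong_ideal_comp (K : scalar_field)
    (HK : K = real_scalars \/ K = complex_scalars)
    (I1 I2 : lip_class K) (N1 N2 : lip_norm K)
    (X1 X2 Z W : pointed_metric) (E F : CompleteNormedModule K)
    (h1 : Z -> X1) (h2 : W -> X2) (T : X1 * X2 -> E) (u : E -> F) :
  normed_lip_operator_ideal K I1 N1 -> normed_lip_operator_ideal K I2 N2 ->
  Lip0 Z X1 h1 -> Lip0 W X2 h2 -> strong_ideal I1 I2 X1 X2 E T -> is_linear u ->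
  strong_ideal I1 I2 Z W F (fun p => u (T (h1 (fst p), h2 (snd p)))) /\
  strong_ideal_norm I1 I2 N1 N2 Z W F (fun p => u (T (h1 (fst p), h2 (snd p)))) <=
  op_norm u * strong_ideal_norm I1 I2 N1 N2 X1 X2 E T * Lip Z X1 h1 * Lip W X2 h2.
Proof.
intros HI1 HI2 Hh1 Hh2 HT Hu.
set (T' := fun p => u (T (h1 (fst p), h2 (snd p)))).
assert (HF' : forall G1 G2 f1 f2 B, strong_factorization I1 I2 T G1 G2 f1 f2 B ->
  strong_factorization I1 I2 T' G1 G2 (fun z => f1 (h1 z)) (fun t => f2 (h2 t))
    (fun p => u (B p))).
{ intros G1 G2 f1 f2 B (Hf1 & Hf2 & HB & HTB).
  split; [apply (lip_ideal_comp _ _ _ _ _ _ _ _ HI1 Hh1 Hf1) |].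
  split; [apply (lip_ideal_comp _ _ _ _ _ _ _ _ HI2 Hh2 Hf2) |].
  split; [apply (bilinear_postcomp K HK _ _ _ _ B u HB Hu) |].
  intros z t; exact (f_equal u (HTB (h1 z) (h2 t))). }
split.
- destruct HT as (_ & G1 & G2 & f1 & f2 & B & HF).
  apply (strong_ideal_intro K HK _ _ _ _ _ _ _ _ _ _ _ _ _ HI1 HI2
    (HF' _ _ _ _ _ HF)).
- assert (P1 := Lip_ge_0 _ _ _ Hh1); assert (P2 := Lip_ge_0 _ _ _ Hh2).
  assert (P0 := op_norm_ge_0 u Hu).
  replace (op_norm u * strong_ideal_norm I1 I2 N1 N2 X1 X2 E T *
    Lip Z X1 h1 * Lip W X2 h2) with
    (op_norm u * Lip Z X1 h1 * Lip W X2 h2 *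
     strong_ideal_norm I1 I2 N1 N2 X1 X2 E T) by ring.
  apply le_mult_strong_norm; [repeat apply Rmult_le_pos; assumption | exact HT |].
  intros G1 G2 f1 f2 B HF; pose proof HF as (Hf1 & Hf2 & HB & _).
  apply Rle_trans with (1 := strong_norm_le _ _ _ N1 N2 _ _ _ _ _ _ _ _ _
    HI1 HI2 (HF' _ _ _ _ _ HF)).
  destruct (bilinear_postcomp K HK _ _ _ _ B u HB Hu) as [HB' Hb].
  destruct (lip_ideal_comp _ _ _ _ _ _ _ _ HI1 Hh1 Hf1) as [Hg1 Hn1].
  destruct (lip_ideal_comp _ _ _ _ _ _ _ _ HI2 Hh2 Hf2) as [Hg2 Hn2].
  apply Rle_trans with ((op_norm u * bilinear_norm B) *
    (Lip Z X1 h1 * N1 X1 G1 f1) * (Lip W X2 h2 * N2 X2 G2 f2)); [| right; ring].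
  assert (Q0 := bilinear_norm_ge_0 _ HB').
  assert (Q1 := lip_ideal_norm_ge_0 _ _ _ _ _ _ HI1 Hg1).
  assert (Q2 := lip_ideal_norm_ge_0 _ _ _ _ _ _ HI2 Hg2).
  apply Rmult_le_compat; [apply Rmult_le_pos; assumption | exact Q2 | | exact Hn2].
  apply Rmult_le_compat; assumption.
Qed.

Lemma strong_ideal_scal (K : scalar_field)
    (HK : K = real_scalars \/ K = complex_scalars)
    (I1 I2 : lip_class K) (N1 N2 : lip_norm K)
    (X1 X2 : pointed_metric) (E : CompleteNormedModule K) (T : X1 * X2 -> E) (c : K) :
  normed_lip_operator_ideal K I1 N1 -> normed_lip_operator_ideal K I2 N2 ->
  strong_ideal I1 I2 X1 X2 E T ->
  strong_ideal I1 I2 X1 X2 E (fun p => scal c (T p)) /\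
  strong_ideal_norm I1 I2 N1 N2 X1 X2 E (fun p => scal c (T p)) <=
  abs c * strong_ideal_norm I1 I2 N1 N2 X1 X2 E T.
Proof.
intros HI1 HI2 HT.
assert (HF' : forall G1 G2 f1 f2 B, strong_factorization I1 I2 T G1 G2 f1 f2 B ->
  strong_factorization I1 I2 (fun p => scal c (T p)) G1 G2 f1 f2
    (fun p => scal c (B p)) /\
  bilinear_norm (fun p => scal c (B p)) <= abs c * bilinear_norm B).
{ intros G1 G2 f1 f2 B (Hf1 & Hf2 & HB & HTB).
  destruct (scal_linear K HK E c) as [Hl Hn].
  destruct (bilinear_postcomp K HK _ _ _ _ B _ HB Hl) as [HB' Hb].
  split; [split; [exact Hf1 | split; [exact Hf2 | split; [exact HB' |]]] |].
  - intros x1 x2; exact (f_equal (scal c) (HTB x1 x2)).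
  - apply Rle_trans with (1 := Hb); apply Rmult_le_compat_r; [| exact Hn].
    apply bilinear_norm_ge_0, HB. }
split.
- destruct HT as (_ & G1 & G2 & f1 & f2 & B & HF).
  apply (strong_ideal_intro K HK _ _ _ _ _ _ _ _ _ _ _ _ _ HI1 HI2
    (proj1 (HF' _ _ _ _ _ HF))).
- apply le_mult_strong_norm; [apply abs_ge_0 | exact HT |].
  intros G1 G2 f1 f2 B HF; destruct (HF' _ _ _ _ _ HF) as [HcF Hb].
  apply Rle_trans with (1 := strong_norm_le _ _ _ N1 N2 _ _ _ _ _ _ _ _ _
    HI1 HI2 HcF).
  rewrite <- !Rmult_assoc.
  apply Rmult_le_compat_r; [apply (lip_ideal_norm_ge_0 _ _ _ _ _ _ HI2), HF |].
  apply Rmult_le_compat_r; [apply (lip_ideal_norm_ge_0 _ _ _ _ _ _ HI1), HF |].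
  exact Hb.
Qed.

Lemma factorization_sum (K : scalar_field)
    (HK : K = real_scalars \/ K = complex_scalars)
    (I1 I2 : lip_class K) (N1 N2 : lip_norm K)
    (X1 X2 : pointed_metric) (E : CompleteNormedModule K) (S T : X1 * X2 -> E)
    (G1 G2 H1 H2 : CompleteNormedModule K) (f1 : X1 -> G1) (f2 : X2 -> G2)
    (g1 : X1 -> H1) (g2 : X2 -> H2) (B : G1 * G2 -> E) (D : H1 * H2 -> E) :
  normed_lip_operator_ideal K I1 N1 -> normed_lip_operator_ideal K I2 N2 ->
  strong_factorization I1 I2 S G1 G2 f1 f2 B ->
  strong_factorization I1 I2 T H1 H2 g1 g2 D ->
  strong_factorization I1 I2 (fun p => plus (S p) (T p))
    (prod_banach G1 H1) (prod_banach G2 H2)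
    (fun x => (f1 x, g1 x)) (fun x => (f2 x, g2 x)) (bilinear_sum B D).
Proof.
intros HI1 HI2 (Hf1 & Hf2 & HB & HSB) (Hg1 & Hg2 & HD & HTD).
split; [apply (lip_ideal_pair K I1 N1); assumption |].
split; [apply (lip_ideal_pair K I2 N2); assumption |].
split.
- exact (proj1 (bilinear_sum_bounded K HK _ _ _ _ _ B D _ HB HD
    (Rmax_l _ _) (Rmax_r _ _))).
- intros x1 x2; exact (f_equal2 plus (HSB x1 x2) (HTD x1 x2)).
Qed.

(** Scaling f1, f2 by nonzero scalars and B by the inverse scalars does not change
    the composition.  The right scalars have modulus sqrt r divided by the norms
    of f1 and f2; as these may vanish, they are first enlarged to positive
    numbers c1, c2 that still satisfy |B| c1 c2 <= r. *)
Lemma normalized_factorization (K : scalar_field)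
    (HK : K = real_scalars \/ K = complex_scalars)
    (I1 I2 : lip_class K) (N1 N2 : lip_norm K)
    (X1 X2 : pointed_metric) (E : CompleteNormedModule K) (T : X1 * X2 -> E) (r : R) :
  normed_lip_operator_ideal K I1 N1 -> normed_lip_operator_ideal K I2 N2 ->
  strong_ideal I1 I2 X1 X2 E T -> strong_ideal_norm I1 I2 N1 N2 X1 X2 E T < r ->
  exists (G1 G2 : CompleteNormedModule K) (f1 : X1 -> G1) (f2 : X2 -> G2)
    (B : G1 * G2 -> E),
    strong_factorization I1 I2 T G1 G2 f1 f2 B /\ bilinear_norm B <= 1 /\
    N1 X1 G1 f1 <= sqrt r /\ N2 X2 G2 f2 <= sqrt r.
Proof.
intros HI1 HI2 (_ & HT) Hr.
apply Glb_Rbar_approx in Hr.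
2: { destruct HT as (G1 & G2 & f1 & f2 & B & HF).
     eexists; exists G1, G2, f1, f2, B; split; [exact HF | reflexivity]. }
destruct Hr as (t & (G1 & G2 & f1 & f2 & B & (Hf1 & Hf2 & HB & HTB) & ->) & Hr).
set (b := bilinear_norm B) in *; set (a1 := N1 X1 G1 f1) in *.
set (a2 := N2 X2 G2 f2) in *.
assert (P0 : 0 <= b) by apply bilinear_norm_ge_0, HB.
assert (P1 : 0 <= a1) by apply (lip_ideal_norm_ge_0 _ _ _ _ _ _ HI1 Hf1).
assert (P2 : 0 <= a2) by apply (lip_ideal_norm_ge_0 _ _ _ _ _ _ HI2 Hf2).
assert (Hr0 : 0 < r) by (assert (0 <= b * a1 * a2)
  by (repeat apply Rmult_le_pos; assumption); lra).
assert (He : exists c1 c2, a1 <= c1 /\ a2 <= c2 /\ 0 < c1 /\ 0 < c2 /\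
  b * c1 * c2 <= r).
{ (* For e <= 1 the excess |B| ((a1 + e) (a2 + e) - a1 a2) is at most
     e |B| (a1 + a2 + 1). *)
  set (e := Rmin 1 ((r - b * a1 * a2) / (b * (a1 + a2 + 1) + 1))).
  assert (P3 : 0 < b * (a1 + a2 + 1) + 1) by nra.
  assert (He : 0 < e) by (apply Rmin_glb_lt; [lra | apply Rdiv_lt_0_compat; lra]).
  assert (He1 : e <= 1) by apply Rmin_l.
  assert (He2 : e * (b * (a1 + a2 + 1) + 1) <= r - b * a1 * a2).
  { apply Rle_div_r; [exact P3 | apply Rmin_r]. }
  exists (a1 + e), (a2 + e); repeat split; try lra.
  assert (b * (e * e) <= b * e) by (apply Rmult_le_compat_l; nra).
  nra. }
destruct He as (c1 & c2 & A1 & A2 & C1 & C2 & Hc).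
assert (Hs := sqrt_lt_R0 r Hr0).
destruct (scalar_of_abs_inv K HK (sqrt r / c1)) as (k1 & k1' & K1 & Ka1 & Ka1').
{ apply Rdiv_lt_0_compat; assumption. }
destruct (scalar_of_abs_inv K HK (sqrt r / c2)) as (k2 & k2' & K2 & Ka2 & Ka2').
{ apply Rdiv_lt_0_compat; assumption. }
destruct (lip_ideal_scal _ _ _ _ _ k1 f1 HI1 Hf1) as [Hg1 Hn1].
destruct (lip_ideal_scal _ _ _ _ _ k2 f2 HI2 Hf2) as [Hg2 Hn2].
destruct (scal_linear K HK E k1') as [L1 M1].
destruct (scal_linear K HK E k2') as [L2 M2].
destruct (bilinear_postcomp K HK _ _ _ _ B _ HB L1) as [HB1 Hb1].
destruct (bilinear_postcomp K HK _ _ _ _ _ _ HB1 L2) as [HB2 Hb2].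
exists G1, G2, (fun x => scal k1 (f1 x)), (fun x => scal k2 (f2 x)),
  (fun p => scal k2' (scal k1' (B p))).
split; [split; [exact Hg1 | split; [exact Hg2 | split; [exact HB2 |]]] |].
- intros x1 x2.
  rewrite HTB; symmetry.
  transitivity (scal k2' (scal k1' (scal k1 (B (f1 x1, scal k2 (f2 x2)))))).
  + exact (f_equal (fun e => scal k2' (scal k1' e))
      (linear_scal _ (proj1 HB _) k1 (f1 x1))).
  + rewrite (scal_scal_inv k1 k1' _ K1).
    transitivity (scal k2' (scal k2 (B (f1 x1, f2 x2)))).
    * exact (f_equal (scal k2') (linear_scal _ (proj1 (proj2 HB) _) k2 (f2 x2))).
    * exact (scal_scal_inv k2 k2' _ K2).
- split; [| split].
  + apply Rle_trans with (1 := Hb2).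
    apply Rle_trans with (/ (sqrt r / c2) * (/ (sqrt r / c1) * b)).
    * rewrite <- Ka1', <- Ka2'.
      apply Rmult_le_compat; [apply op_norm_ge_0, L2 | apply bilinear_norm_ge_0, HB1
        | exact M2 |].
      apply Rle_trans with (1 := Hb1); apply Rmult_le_compat_r; assumption.
    * replace (/ (sqrt r / c2) * (/ (sqrt r / c1) * b)) with
        (b * c1 * c2 / (sqrt r * sqrt r)) by (field; lra).
      rewrite sqrt_sqrt by lra; apply Rle_div_l; lra.
  + rewrite Hn1, Ka1; fold a1; unfold Rdiv; rewrite Rmult_assoc.
    rewrite <- (Rmult_1_r (sqrt r)) at 2; apply Rmult_le_compat_l; [lra |].
    rewrite Rmult_comm; apply Rle_div_l; lra.
  + rewrite Hn2, Ka2; fold a2; unfold Rdiv; rewrite Rmult_assoc.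
    rewrite <- (Rmult_1_r (sqrt r)) at 2; apply Rmult_le_compat_l; [lra |].
    rewrite Rmult_comm; apply Rle_div_l; lra.
Qed.

Lemma strong_norm_ge_0 (K : scalar_field)
    (HK : K = real_scalars \/ K = complex_scalars)
    (I1 I2 : lip_class K) (N1 N2 : lip_norm K)
    (X1 X2 : pointed_metric) (E : CompleteNormedModule K) (T : X1 * X2 -> E) :
  normed_lip_operator_ideal K I1 N1 -> normed_lip_operator_ideal K I2 N2 ->
  strong_ideal I1 I2 X1 X2 E T -> 0 <= strong_ideal_norm I1 I2 N1 N2 X1 X2 E T.
Proof.
intros HI1 HI2 HT; apply le_strong_norm; [exact HT |].
intros G1 G2 f1 f2 B HF.
apply (factorization_blip_bound K HK _ _ _ _ _ _ _ _ _ _ _ _ _ HI1 HI2 HF).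
Qed.

(** With balanced factorizations the sum has norm at most
    (sqrt s' + sqrt t')^2 <= 2 (s' + t'), for all s' > |S| and t' > |T|. *)
Lemma strong_ideal_plus (K : scalar_field)
    (HK : K = real_scalars \/ K = complex_scalars)
    (I1 I2 : lip_class K) (N1 N2 : lip_norm K)
    (X1 X2 : pointed_metric) (E : CompleteNormedModule K) (S T : X1 * X2 -> E) :
  normed_lip_operator_ideal K I1 N1 -> normed_lip_operator_ideal K I2 N2 ->
  strong_ideal I1 I2 X1 X2 E S -> strong_ideal I1 I2 X1 X2 E T ->
  strong_ideal I1 I2 X1 X2 E (fun p => plus (S p) (T p)) /\
  strong_ideal_norm I1 I2 N1 N2 X1 X2 E (fun p => plus (S p) (T p)) <=
  2 * (strong_ideal_norm I1 I2 N1 N2 X1 X2 E S +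
       strong_ideal_norm I1 I2 N1 N2 X1 X2 E T).
Proof.
intros HI1 HI2 HS HT; split.
- destruct HS as (_ & G1 & G2 & f1 & f2 & B & HFS).
  destruct HT as (_ & L1 & L2 & g1 & g2 & D & HFT).
  apply (strong_ideal_intro K HK _ _ _ _ _ _ _ _ _ _ _ _ _ HI1 HI2
    (factorization_sum K HK _ _ _ _ _ _ _ _ _ _ _ _ _ _ _ _ _ _ _ HI1 HI2 HFS HFT)).
- set (s := strong_ideal_norm I1 I2 N1 N2 X1 X2 E S).
  set (t := strong_ideal_norm I1 I2 N1 N2 X1 X2 E T).
  apply le_epsilon; intros eps He.
  assert (Hs : s < s + eps / 4) by lra.
  assert (Ht : t < t + eps / 4) by lra.
  set (s' := s + eps / 4) in *; set (t' := t + eps / 4) in *.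
  destruct (normalized_factorization K HK _ _ _ _ _ _ _ S s' HI1 HI2 HS Hs)
    as (G1 & G2 & f1 & f2 & B & HFS & HB1 & A1 & A2).
  destruct (normalized_factorization K HK _ _ _ _ _ _ _ T t' HI1 HI2 HT Ht)
    as (L1 & L2 & g1 & g2 & D & HFT & HD1 & C1 & C2).
  assert (HF := factorization_sum K HK _ _ _ _ _ _ _ _ _ _ _ _ _ _ _ _ _ _ _
    HI1 HI2 HFS HFT).
  apply Rle_trans with (1 := strong_norm_le _ _ _ N1 N2 _ _ _ _ _ _ _ _ _
    HI1 HI2 HF).
  pose proof HFS as (Hf1 & Hf2 & HB & _); pose proof HFT as (Hg1 & Hg2 & HD & _).
  destruct (lip_ideal_pair _ _ _ _ _ _ _ _ HI1 Hf1 Hg1) as [J1 P1].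
  destruct (lip_ideal_pair _ _ _ _ _ _ _ _ HI2 Hf2 Hg2) as [J2 P2].
  destruct (bilinear_sum_bounded K HK _ _ _ _ _ B D 1 HB HD HB1 HD1) as [HBD HBD1].
  assert (Q1 := lip_ideal_norm_ge_0 _ _ _ _ _ _ HI1 J1).
  assert (Q2 := lip_ideal_norm_ge_0 _ _ _ _ _ _ HI2 J2).
  assert (Q0 := bilinear_norm_ge_0 _ HBD).
  apply Rle_trans with
    (1 * (sqrt s' + sqrt t') * (sqrt s' + sqrt t')).
  + apply Rmult_le_compat;
      [apply Rmult_le_pos; assumption | exact Q2 | | lra].
    apply Rmult_le_compat; [exact Q0 | exact Q1 | exact HBD1 | lra].
  + assert (Zs := strong_norm_ge_0 K HK I1 I2 N1 N2 _ _ _ S HI1 HI2 HS : 0 <= s).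
    assert (Zt := strong_norm_ge_0 K HK I1 I2 N1 N2 _ _ _ T HI1 HI2 HT : 0 <= t).
    assert (E1 := sqrt_sqrt s' ltac:(unfold s'; lra)).
    assert (E2 := sqrt_sqrt t' ltac:(unfold t'; lra)).
    assert (H := pow2_ge_0 (sqrt s' - sqrt t')).
    replace (2 * (s + t) + eps) with (2 * (s' + t')) by (unfold s', t'; lra).
    nra.
Qed.

Lemma BLip_le_strong_norm (K : scalar_field)
    (HK : K = real_scalars \/ K = complex_scalars)
    (I1 I2 : lip_class K) (N1 N2 : lip_norm K)
    (X1 X2 : pointed_metric) (E : CompleteNormedModule K) (T : X1 * X2 -> E) :
  normed_lip_operator_ideal K I1 N1 -> normed_lip_operator_ideal K I2 N2 ->
  strong_ideal I1 I2 X1 X2 E T ->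
  BLip T <= strong_ideal_norm I1 I2 N1 N2 X1 X2 E T.
Proof.
intros HI1 HI2 HT; apply le_strong_norm; [exact HT |].
intros G1 G2 f1 f2 B HF; apply Glb_Rbar_le with 0; [intros C HC; apply HC |].
apply (factorization_blip_bound K HK _ _ _ _ _ _ _ _ _ _ _ _ _ HI1 HI2 HF).
Qed.

(** Second differences against the base points reduce to the value of the map,
    since it vanishes as soon as one of its arguments is the base point. *)
Lemma norm_le_BLip {K : AbsRing} (X1 X2 : pointed_metric)
    (E : CompleteNormedModule K) (T : X1 * X2 -> E) (x1 : X1) (x2 : X2) :
  BLip0 T ->
  norm (T (x1, x2)) <= BLip T * (dist X1 x1 (pm_base X1) * dist X2 x2 (pm_base X2)).
Proof.
intros (H1 & H2 & He).
set (d := dist X1 x1 (pm_base X1) * dist X2 x2 (pm_base X2)).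
assert (HC : forall C, blip_bound T C -> norm (T (x1, x2)) <= C * d).
{ intros C [_ HC]; specialize (HC x1 (pm_base X1) x2 (pm_base X2)).
  rewrite !H1, !H2 in HC.
  unfold d; rewrite <- Rmult_assoc; apply Rle_trans with (2 := HC), Req_le.
  apply (f_equal norm); symmetry.
  transitivity (minus (minus (T (x1, x2)) zero) zero); [exact (plus_zero_r _) |].
  transitivity (minus (T (x1, x2)) zero); exact (minus_zero_r _). }
assert (Hd : 0 <= d) by (apply Rmult_le_pos; apply dist_ge_0).
destruct Hd as [Hd | Hd].
- apply Rle_div_l; [exact Hd |].
  apply le_Glb_Rbar; [exact He |].
  intros C HCb; apply Rle_div_l; [exact Hd | exact (HC C HCb)].
- destruct He as [C HCb]; generalize (HC C HCb); rewrite <- Hd; lra.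
Qed.

Lemma scalar_product_factorization (K : scalar_field)
    (HK : K = real_scalars \/ K = complex_scalars)
    (I1 I2 : lip_class K) (X1 X2 : pointed_metric) (E : CompleteNormedModule K)
    (f1 : X1 -> K) (f2 : X2 -> K) (u : scalar_banach K -> E) :
  lip_operator_ideal K I1 -> lip_operator_ideal K I2 ->
  Lip0 X1 (scalar_pm K) f1 -> Lip0 X2 (scalar_pm K) f2 -> is_linear u ->
  strong_factorization I1 I2 (fun x => u (mult (f1 (fst x)) (f2 (snd x))))
    (scalar_banach K) (scalar_banach K) f1 f2 (fun p => u (scalar_mult K p)).
Proof.
intros H1 H2 Hf1 Hf2 Hu.
split; [apply lip_ideal_scalar; assumption |].
split; [apply lip_ideal_scalar; assumption |].
split; [| reflexivity].
apply (bilinear_postcomp K HK _ _ _ _ (scalar_mult K) u); [| exact Hu].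
apply scalar_mult_bilinear, HK.
Qed.

Lemma BLip_scalar_mult (K : scalar_field)
    (HK : K = real_scalars \/ K = complex_scalars) :
  BLip0 (X1 := scalar_pm K) (X2 := scalar_pm K) (scalar_mult K) ->
  1 <= BLip (X1 := scalar_pm K) (X2 := scalar_pm K) (scalar_mult K).
Proof.
intros HT.
assert (Hone : forall x : scalar_banach K, dist (scalar_pm K) x (pm_base (scalar_pm K)) = norm x).
{ intros x; change (norm (minus x zero) = norm x); f_equal.
  unfold minus; rewrite opp_zero; apply plus_zero_r. }
assert (Hn : norm ((one : K) : scalar_banach K) = 1)
  by (rewrite scalar_banach_norm by exact HK; exact abs_one).
assert (H := norm_le_BLip (scalar_pm K) (scalar_pm K) _ _ (one : K) (one : K) HT).
rewrite (Hone (one : K)), Hn, !Rmult_1_r in H.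
apply Rle_trans with (2 := H), Req_le; rewrite <- Hn at 1.
apply (f_equal norm); symmetry; exact (mult_one_l (one : K)).
Qed.

Theorem proposition5p15 (K : scalar_field)
    (HK : K = real_scalars \/ K = complex_scalars)
    (I1 I2 : lip_class K) (N1 N2 : lip_norm K)
    (H1 : normed_lip_operator_ideal K I1 N1)
    (H2 : normed_lip_operator_ideal K I2 N2) :
  quasi_normed_two_lip_operator_ideal K (strong_ideal I1 I2)
    (strong_ideal_norm I1 I2 N1 N2).
Proof.
pose proof (nloi_ideal _ _ _ H1) as J1.
pose proof (nloi_ideal _ _ _ H2) as J2.
split; [split | | | |].
- intros X1 X2 E T HT; apply HT.
- intros X1 X2 E; split; [| split].
  + apply (strong_ideal_intro K HK I1 I2 N1 N2 X1 X2 E _ E E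
      (fun _ => zero) (fun _ => zero) (fun _ => zero) H1 H2).
    split; [apply (loi_subspace _ _ J1) |].
    split; [apply (loi_subspace _ _ J2) |].
    split; [exact (bilinear_zero E E E) | reflexivity].
  + intros S T HS HT; apply (strong_ideal_plus K HK I1 I2 N1 N2); assumption.
  + intros c T HT; apply (strong_ideal_scal K HK I1 I2 N1 N2); assumption.
- intros X1 X2 E f1 f2 e Hf1 Hf2.
  apply (strong_ideal_intro K HK I1 I2 N1 N2 _ _ _ _ _ _ _ _ _ H1 H2
    (scalar_product_factorization K HK I1 I2 X1 X2 E f1 f2 _ J1 J2 Hf1 Hf2
       (scalar_scal_linear K HK E e))).
- intros X1 X2 Z W E F h1 h2 T u Hh1 Hh2 HT Hu.
  apply (strong_ideal_comp K HK I1 I2 N1 N2); assumption.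
- intros X1 X2 E; exists 2; split; [lra |].
  assert (Hscal : forall (c : K) T, strong_ideal I1 I2 X1 X2 E T ->
    strong_ideal_norm I1 I2 N1 N2 X1 X2 E (fun p => scal c (T p)) <=
    abs c * strong_ideal_norm I1 I2 N1 N2 X1 X2 E T).
  { intros c T HT; apply (strong_ideal_scal K HK I1 I2 N1 N2); assumption. }
  assert (Hpos : forall T, strong_ideal I1 I2 X1 X2 E T ->
    0 <= strong_ideal_norm I1 I2 N1 N2 X1 X2 E T).
  { intros T HT; apply (strong_norm_ge_0 K HK); assumption. }
  split; [exact Hpos | split; [| split]].
  + intros T HT H0 [x1 x2]; apply (norm_eq_zero (V := E)).
    apply Rle_antisym; [| apply norm_ge_0].
    assert (Hb := BLip_le_strong_norm K HK I1 I2 N1 N2 _ _ _ T H1 H2 HT).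
    apply Rle_trans with (1 := norm_le_BLip X1 X2 E T x1 x2 (proj1 HT)).
    assert (Hd := Rmult_le_pos _ _ (dist_ge_0 X1 x1 (pm_base X1))
      (dist_ge_0 X2 x2 (pm_base X2))).
    rewrite H0 in Hb; nra.
  + intros c T HT; apply Rle_antisym; [exact (Hscal c T HT) |].
    assert (HcT : strong_ideal I1 I2 X1 X2 E (fun p => scal c (T p)))
      by (apply (strong_ideal_scal K HK I1 I2 N1 N2); assumption).
    destruct (scalar_inv K HK c) as [-> | (c' & Hc & Ha)].
    * rewrite abs_zero, Rmult_0_l; apply Hpos, HcT.
    * assert (HTc : (fun p => scal c' (scal c (T p))) = T)
        by (apply functional_extensionality; intros p;
            exact (scal_scal_inv c c' (T p) Hc)).
      assert (H : strong_ideal_norm I1 I2 N1 N2 X1 X2 E T <=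
          abs c' * strong_ideal_norm I1 I2 N1 N2 X1 X2 E (fun p => scal c (T p)))
        by (rewrite <- HTc at 1; exact (Hscal c' _ HcT)).
      apply Rle_trans with (1 := Rmult_le_compat_l _ _ _ (abs_ge_0 c) H).
      rewrite <- Rmult_assoc, (Rmult_comm (abs c)), Ha; lra.
  + intros S T HS HT; apply (strong_ideal_plus K HK); assumption.
- intros X1 X2 E T HT; apply (BLip_le_strong_norm K HK); assumption.
- assert (HF := scalar_product_factorization K HK I1 I2 (scalar_pm K) (scalar_pm K)
    (scalar_banach K) (fun x => x) (fun x => x) (fun x => x) J1 J2
    (Lip0_id _) (Lip0_id _) is_linear_id).
  assert (HT := strong_ideal_intro K HK I1 I2 N1 N2 _ _ _ _ _ _ _ _ _ H1 H2 HF).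
  apply Rle_antisym.
  + apply Rle_trans with (1 := strong_norm_le K I1 I2 N1 N2 _ _ _ _ _ _ _ _ _ H1 H2 HF).
    apply Rle_trans with (bilinear_norm (scalar_mult K) * 1 * 1).
    * right; exact (f_equal2 Rmult (f_equal2 Rmult eq_refl (nloi_id _ _ _ H1))
        (nloi_id _ _ _ H2)).
    * rewrite !Rmult_1_r; exact (proj2 (scalar_mult_bilinear K HK)).
  + apply Rle_trans with (1 := BLip_scalar_mult K HK (proj1 HT)).
    exact (BLip_le_strong_norm K HK I1 I2 N1 N2 _ _ _ _ H1 H2 HT).
- intros X1 X2 Z W E F h1 h2 T u Hh1 Hh2 HT Hu.
  apply (strong_ideal_comp K HK I1 I2 N1 N2); assumption.
Qed.
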